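(* Let $K$ be a field, let $m\leq n$ be positive integers, let $X=(x_{i,j})$ be an $m\times n$ matrix of indeterminates, and let $I_m(X)$ be the ideal of $K[X]$ generated by the size $m$ (maximal) minors of $X$. Then the pair $(K[X],I_m(X))$ has the property $\mathbf{P}$.
   Context: Property $\mathbf{P}$: Let $R$ be a polynomial ring over a field and $I$ an unmixed homogeneous ideal (all associated primes of the same height). The pair $(R,I)$ has $\mathbf{P}$ if, for some fixed term order $<$ on $R$, there exist homogeneous elements $\alpha_1,\ldots,\alpha_{\operatorname{ht}(I)}$ in $I$ (where $\operatorname{ht}$ denotes height) such that each initial term $\operatorname{in}_<(\alpha_i)$ is squarefree and $\operatorname{in}_<(\alpha_i),\operatorname{in}_<(\alpha_j)$ are coprime for all $i\neq j$. *)

(* Defs.v *)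
From HB Require Import structures.
From mathcomp Require Import all_boot all_order all_algebra.
From mathcomp Require Import boolp.
From mathcomp Require Import mpoly.

Set Implicit Arguments.
Unset Strict Implicit.
Unset Printing Implicit Defensive.

Import GRing.Theory.
Local Open Scope ring_scope.

(* Ideals are boolean predicates, as in ring_quotient; the reflection `[< _ >]
   of arbitrary propositions makes every subset available as such a predicate.
   idealr_closed already includes properness (1 \notin I). *)

Section Ideals.
Variable R : comNzRingType.
Implicit Types (I P : {pred R}) (gs : seq R).

Definition ideal_gen gs : {pred R} :=
  fun f => `[< exists c : 'I_(size gs) -> R, f = \sum_i c i * gs`_i >].

Definition prime_ideal P : Prop := idealr_closed P /\ prime_idealr_closed P.

(* P_0 < P_1 < ... < P_k = P, a strict chain of primes of length k *)
Definition prime_chain P (k : nat) : Prop :=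
  exists c : nat -> {pred R},
    [/\ forall i, (i <= k)%N -> prime_ideal (c i),
        forall i, (i < k)%N ->
          {subset c i <= c i.+1} /\ ~ {subset c i.+1 <= c i}
      & c k =i P].

Definition prime_height P (h : nat) : Prop :=
  [/\ prime_ideal P, prime_chain P h
    & forall k, prime_chain P k -> (k <= h)%N].

(* The least height of a prime containing I; a prime of infinite height
   satisfies no prime_height _ k, hence does not affect the minimum. *)
Definition ideal_height I (h : nat) : Prop :=
  (exists2 P, {subset I <= P} & prime_height P h) /\
  (forall P k, {subset I <= P} -> prime_height P k -> (h <= k)%N).

(* P = (I : f), the annihilator of the class of f in R / I *)
Definition associated_prime I P : Prop :=
  prime_ideal P /\ exists f, forall g, (g \in P) = (g * f \in I).

Definition unmixed I : Prop :=
  exists h, forall P, associated_prime I P -> prime_height P h.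

End Ideals.

Section Monomials.
Variable N : nat.
Implicit Types (u v w : 'X_{1..N}) (le : rel 'X_{1..N}).

Definition term_order le : Prop :=
  [/\ reflexive le, antisymmetric le, transitive le & total le] /\
  [/\ forall u, le 0%MM u
    & forall u v w, le u v -> le (u + w)%MM (v + w)%MM].

Definition squarefree_mnm u : Prop := forall k, (u k <= 1)%N.

Definition coprime_mnm u v : Prop := forall k, minn (u k) (v k) = 0%N.

End Monomials.

Section PropertyP.
Variables (K : fieldType) (N : nat).
Implicit Types (le : rel 'X_{1..N}) (p : {mpoly K[N]}) (I : {pred {mpoly K[N]}}).

(* The monomial of the initial term of p; the coefficient, a unit of K, is
   dropped. Meaningful only for p != 0: the value at 0 is the monomial 1. *)
Definition initial_mnm le p : 'X_{1..N} :=
  foldr (fun u v => if le u v then v else u) 0%MM (msupp p).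

Definition homogeneous_ideal I : Prop :=
  idealr_closed I /\ forall p d, p \in I -> pihomog mdeg d p \in I.

Definition property_P I : Prop :=
  [/\ homogeneous_ideal I, unmixed I
    & exists2 h, ideal_height I h &
      exists2 le : rel 'X_{1..N}, term_order le &
      exists alpha : 'I_h -> {mpoly K[N]},
        [/\ forall i, alpha i \in I,
            forall i, alpha i \is homog mdeg,
            forall i, alpha i != 0,
            forall i, squarefree_mnm (initial_mnm le (alpha i))
          & forall i j, i != j ->
              coprime_mnm (initial_mnm le (alpha i))
                          (initial_mnm le (alpha j))]].

End PropertyP.

Section Determinantal.
Variables (m n : nat).

Definition generic_mx (K : fieldType) : 'M[{mpoly K[m * n]}]_(m, n) :=
  \matrix_(i, j) 'X_(mxvec_index i j).

Definition increasing (t s : nat) (f : {ffun 'I_t -> 'I_s}) : bool :=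
  [forall i : 'I_t, forall j : 'I_t, (i < j)%N ==> (f i < f j)%N].

Definition minors (R : comNzRingType) (t : nat) (A : 'M[R]_(m, n)) : seq R :=
  [seq \det (mxsub fg.1 fg.2 A)
     | fg : {ffun 'I_t -> 'I_m} * {ffun 'I_t -> 'I_n}
       in [pred fg | increasing fg.1 && increasing fg.2]].

Definition minors_ideal (R : comNzRingType) (t : nat) (A : 'M[R]_(m, n)) :
  {pred R} := ideal_gen (minors t A).

End Determinantal.

(* Main.v *)
From HB Require Import structures.
Require Import Defs.
From mathcomp Require Import all_boot all_order all_algebra.
From mathcomp Require Import fingroup perm ring zify boolp.
From mathcomp Require Import mpoly ssrcomplements.

Set Implicit Arguments.
Unset Strict Implicit.
Unset Printing Implicit Defensive.

Import Order.TTheory GRing.Theory.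
Local Open Scope ring_scope.

(** The term order is the degree-lexicographic one with
    x_11 > x_12 > ... > x_1n > x_21 > ..., for which the initial term of a
    minor is the product of its main diagonal ([lead_minor]).  The maximal
    minors on the columns i, ..., i+m-1, for i = 1, ..., n-m+1, then have
    squarefree and pairwise coprime initial terms, so what has to be proved is
    that the ideal I of maximal minors is unmixed of height exactly n-m+1.

    Both facts come from the stronger statement that I is prime, proved for
    the ideals J_k of maximal minors of the first k columns all at once.

    - The maximal minors are a Groebner basis ([lead_maxminors_ideal]).
      Expanding an (m+1) x (m+1) determinant with a repeated row gives linear
      relations between maximal minors; used as rewriting rules, they bring
      every element of J_k to the form sum_c h_c [c] in which the variables
      occurring in h_c are restricted so that the products of monomials of h_c
      with the diagonal of [c] are pairwise distinct ([straighten],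
      [reduced_diag_inj]).  The initial terms of the summands cannot cancel,
      and one of them is the initial term of the sum.

    - Let delta be the minor of the rows 2, ..., m and the columns
      1, ..., m-1.  Its initial term involves only variables below the main
      diagonal, hence is coprime to all main diagonals, and the Groebner basis
      shows that delta is a nonzerodivisor modulo J_k ([delta_regular]).  By
      Cramer's rule, up to a power of delta every polynomial is congruent
      modulo J_k to one in the subring S of polynomials free of the variables
      x_1j with m <= j <= k ([delta_reduction]).  Finally S meets J_k only in
      0: over the field of fractions, these entries of X can be replaced so
      that in the first k columns the first row becomes a combination of the
      others ([kill_excluded_maxminors_ideal]).  So J_k is prime
      ([maxminors_ideal_prime]).

    - The chain 0 = J_{m-1} < J_m < ... < J_n = I gives height at least n-m+1.
      For the other inequality, when k = n the ring S omits n-m+1 variables and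
      its monomials are linearly independent modulo I, which gives
      d ^ (mn - (n-m+1)) independent elements of degree O(d); going down one
      step in a chain of primes multiplies the number of independent elements
      by d ([growth_step]), and in mn variables there are at most O(d ^ (mn))
      of them ([growth_le]).

    A prime ideal is its only associated prime, and its height in the sense of
    chains is the least height of the primes that contain it
    ([prime_associated], [prime_ideal_height]). *)

(** * Orderings, ordinals and polynomial rings *)

Lemma increasingP t s (f : {ffun 'I_t -> 'I_s}) :
  reflect {homo f : i j / (i < j)%N} (increasing f).
Proof.
apply: (iffP forallP) => [incf i j|incf i].
  by move/forallP/(_ j)/implyP: (incf i).
by apply/forallP => j; apply/implyP/incf.
Qed.

Lemma homo_ltn_inj t s (f : 'I_t -> 'I_s) :
  {homo f : i j / (i < j)%N} -> injective f.
Proof.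
move=> incf i j eq_f; case: (ltngtP i j) => [/incf|/incf|/val_inj] //;
  by rewrite eq_f ltnn.
Qed.

Lemma increasing_ge p n (c : {ffun 'I_p -> 'I_n}) (i : 'I_p) :
  increasing c -> (i <= c i)%N.
Proof.
move/increasingP => incc; case: i => i; elim: i => //= i IHi lt_ip.
apply: leq_ltn_trans (IHi (ltnW lt_ip)) _; exact: incc.
Qed.

Lemma increasing_id p (f : {ffun 'I_p -> 'I_p}) : increasing f -> f =1 id.
Proof.
move=> incf i; apply/val_inj/eqP; rewrite eqn_leq increasing_ge // andbT.
pose g : {ffun 'I_p -> 'I_p} := [ffun i => rev_ord (f (rev_ord i))].
have incg : increasing g.
  apply/increasingP => i1 i2 lt_i; rewrite !ffunE /=.
  have := ltn_ord (f (rev_ord i1)).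
  have : (f (rev_ord i2) < f (rev_ord i1))%N.
    by apply: (increasingP _ incf) => /=; move: (ltn_ord i2); lia.
  by lia.
have := increasing_ge (rev_ord i) incg; rewrite ffunE rev_ordK /=.
by move: (ltn_ord (f i)) (ltn_ord i); lia.
Qed.

Lemma first_diff t (T : eqType) (f g : 'I_t -> T) : ~ f =1 g ->
  exists2 r : 'I_t, f r != g r & forall s : 'I_t, (s < r)%N -> f s = g s.
Proof.
move=> ne_fg; have [r0 ne_r0] : exists r, f r != g r.
  apply/existsP; apply: contra_notT ne_fg => /existsPn eq_fg r.
  exact/eqP/negPn.
case: (@arg_minnP _ r0 (fun r => f r != g r) (fun r : 'I_t => r : nat) ne_r0).
move=> r ne_r minr; exists r => // s lt_sr; apply/eqP/negPn/negP => /minr.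
by rewrite leqNgt lt_sr.
Qed.

Lemma neq_of_ltn p (j j' : 'I_p) : (j' < j)%N -> (j == j') = false.
Proof. by move=> lt_j; apply/eqP => eq_j; rewrite eq_j ltnn in lt_j. Qed.

Lemma lift_lt m (q : 'I_m.+1) (r : 'I_m) :
  (r < q)%N -> lift q r = widen_ord (leqnSn m) r.
Proof. by move=> lt_rq; apply: val_inj; rewrite /= /bump leqNgt lt_rq. Qed.

Lemma lift_ge m (q : 'I_m.+1) (r : 'I_m) :
  (q <= r)%N -> lift q r = lift ord0 r.
Proof. by move=> le_qr; apply: val_inj; rewrite /= /bump le_qr. Qed.

Lemma ltn_sum_at (I : finType) (f g : I -> nat) i :
  (forall r, f r <= g r)%N -> (f i < g i)%N -> (\sum_r f r < \sum_r g r)%N.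
Proof.
move=> le_fg lt_i; rewrite (bigD1 i) //= [X in (_ < X)%N](bigD1 i) //=.
by rewrite -addSn leq_add // leq_sum.
Qed.

Lemma scale_sign (K : fieldType) N (e : nat) (f : {mpoly K[N]}) :
  ((-1) ^+ e : K) *: f = (-1) ^+ e * f.
Proof.
rewrite -(signr_odd K) -(signr_odd {mpoly K[N]}).
by case: odd; rewrite ?(expr0, expr1) ?mulN1r ?mul1r ?scaleN1r ?scale1r.
Qed.

Lemma mpoly_rmorph_ind (K : fieldType) N (P : {mpoly K[N]} -> Prop) :
    (forall a, P a%:MP) -> (forall q, P 'X_q) ->
    (forall f g, P f -> P g -> P (f + g)) ->
    (forall f g, P f -> P g -> P (f * g)) ->
  forall f, P f.
Proof.
move=> PC PX PD PM f; rewrite [f]mpolyE.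
apply: big_ind => [||u _]; [by rewrite -mpolyC0 | exact: PD|].
rewrite -mul_mpolyC; apply: (PM) => //; rewrite mpolyXE_id.
apply: big_ind => [||q _]; [by rewrite -mpolyC1 | exact: PM|].
elim: (u q) => [|e IHe]; first by rewrite expr0 -mpolyC1.
by rewrite exprS; apply: (PM).
Qed.

Lemma eq_mpoly_rmorph (K : fieldType) N (A : nzRingType)
    (phi psi : {rmorphism {mpoly K[N]} -> A}) :
  (forall a, phi a%:MP = psi a%:MP) -> (forall q, phi 'X_q = psi 'X_q) ->
  phi =1 psi.
Proof.
move=> eqC eqX; apply: mpoly_rmorph_ind => // f g eqf eqg.
  by rewrite !rmorphD eqf eqg.
by rewrite !rmorphM eqf eqg.
Qed.

Lemma ideal_gen_mem (A : comNzRingType) (gs : seq A) g :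
  g \in gs -> g \in ideal_gen gs.
Proof.
move=> g_gs; apply/asboolP.
have lt_i : (index g gs < size gs)%N by rewrite index_mem.
exists (fun i => (i == Ordinal lt_i)%:R).
rewrite (bigD1 (Ordinal lt_i)) //= eqxx mul1r nth_index // big1 ?addr0 // => i.
by move=> /negPf->; rewrite mul0r.
Qed.

Lemma ideal_gen0 (A : comNzRingType) (gs : seq A) : 0 \in ideal_gen gs.
Proof.
by apply/asboolP; exists (fun _ => 0); rewrite big1 // => i _; rewrite mul0r.
Qed.

Lemma ideal_gen_linear (A : comNzRingType) (gs : seq A) a f g :
  f \in ideal_gen gs -> g \in ideal_gen gs -> a * f + g \in ideal_gen gs.
Proof.
move=> /asboolP[b ->] /asboolP[c ->]; apply/asboolP.
exists (fun i => a * b i + c i); rewrite mulr_sumr -big_split.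
by apply: eq_bigr => i _; rewrite mulrDl mulrA.
Qed.

Lemma index_allpairs_pair (S T : eqType) (s : seq S) (t : seq T) x y :
  x \in s -> y \in t ->
  index (x, y) [seq (a, b) | a <- s, b <- t]
    = (index x s * size t + index y t)%N.
Proof.
move=> xs yt; elim: s xs => //= a s IHs; rewrite inE index_cat size_map.
have pair_inj b : injective (@pair S T b) by move=> ? ? [].
case: (eqVneq a x) => [<- _|ne_ax] /=.
  by rewrite mem_map // yt index_map // mul0n.
move=> xs.
case: ifP => [/mapP[b _ [eq_xa]]|_]; first by rewrite eq_xa eqxx in ne_ax.
by rewrite IHs // mulSn addnA.
Qed.

Lemma mxvec_indexE m n (i : 'I_m) (j : 'I_n) :
  mxvec_index i j = (i * n + j)%N :> nat.
Proof.
rewrite /=; set x := (i, j); have <- : index x (enum {: 'I_m * 'I_n}) = enum_rank x.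
  by rewrite -{1}(nth_enum_rank x x) index_uniq ?enum_uniq // -cardE.
rewrite enumT unlock /= /prod_enum index_allpairs_pair ?mem_enum //.
by rewrite size_enum_ord !index_enum_ord.
Qed.

Lemma mxvec_index_inj m n (i i' : 'I_m) (j j' : 'I_n) :
  (mxvec_index i j == mxvec_index i' j') = (i == i') && (j == j').
Proof.
by apply/eqP/andP => [/cast_ord_inj/enum_rank_inj[-> ->]|[/eqP-> /eqP->]].
Qed.

Lemma ltn_mxvec_index m n (i i' : 'I_m) (j j' : 'I_n) :
  (mxvec_index i j < mxvec_index i' j')%N
    = (i < i')%N || (i == i') && (j < j')%N.
Proof.
rewrite !mxvec_indexE; have jn := ltn_ord j; have jn' := ltn_ord j'.
case: (ltngtP i i') => /= [lt_ii'|lt_i'i|/val_inj->].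
- by have := leq_mul2r n i.+1 i'; rewrite lt_ii' orbT mulSn => le; lia.
- have := leq_mul2r n i'.+1 i; rewrite lt_i'i orbT mulSn => le.
  have -> : (i == i') = false by apply/eqP => eq_i; rewrite eq_i ltnn in lt_i'i.
  by rewrite /=; lia.
- by rewrite eqxx ltn_add2l.
Qed.

(** * Initial terms of minors *)

Section Minors.
Variables (K : fieldType) (m n : nat).
Local Notation R := {mpoly K[m * n]}.
Local Notation X := (generic_mx m n K).
Local Notation idx := (@mxvec_index m n).

(** Row-major numbering of the entries turns the comparison of two monomials of
    the same degree into the comparison at the first differing entry. *)
Lemma lex_lt_mnm (u v : 'X_{1..m * n}) (i : 'I_m) (j : 'I_n) : mdeg u = mdeg v ->
    (forall i' : 'I_m, (i' < i)%N -> forall j', u (idx i' j') = v (idx i' j')) ->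
    (forall j' : 'I_n, (j' < j)%N -> u (idx i j') = v (idx i j')) ->
  (u (idx i j) < v (idx i j))%N -> (u < v)%O.
Proof.
move=> eq_deg eq_row eq_col lt_uv; apply/(ltmcP eq_deg).
exists (idx i j) => // q; case: (mxvec_indexP q) => i' j'.
rewrite ltn_mxvec_index => /orP[/eq_row-> //|/andP[/eqP-> /eq_col->]] //.
Qed.

(** The rows are selected by rho so that the same monomial describes the
    initial term of a minor of any size. *)
Definition diag t (rho : 'I_t -> 'I_m) (c : 'I_t -> 'I_n) : 'X_{1..m * n} :=
  (\sum_r U_(idx (rho r) (c r)))%MM.

Lemma diagE t (rho : 'I_t -> 'I_m) c i j :
  diag rho c (idx i j) = (\sum_r (rho r == i) && (c r == j))%N.
Proof. by rewrite mnm_sumE; apply: eq_bigr => r _; rewrite mnm1E mxvec_index_inj. Qed.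

Lemma diag_row t (rho : 'I_t -> 'I_m) c r j : injective rho ->
  diag rho c (idx (rho r) j) = (c r == j).
Proof.
move=> rho_inj; rewrite diagE (bigD1 r) //= eqxx big1 ?addn0 // => s ne_sr.
by rewrite (inj_eq rho_inj) (negPf ne_sr).
Qed.

Lemma diag_id (c : 'I_m -> 'I_n) r j : diag id c (idx r j) = (c r == j).
Proof. exact: (@diag_row _ id). Qed.

Lemma mdeg_diag t (rho : 'I_t -> 'I_m) c : mdeg (diag rho c) = t.
Proof.
rewrite mdeg_sum (eq_bigr (fun _ => 1%N)) ?sum1_card ?card_ord // => r _.
exact: mdeg1.
Qed.

Lemma diag_lt t (rho : 'I_t -> 'I_m) (c c' : 'I_t -> 'I_n) (r : 'I_t) :
    {homo rho : i j / (i < j)%N} ->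
    (forall s : 'I_t, (s < r)%N -> c s = c' s) -> (c' r < c r)%N ->
  (diag rho c < diag rho c')%O.
Proof.
move=> inc_rho eq_c lt_c; have inj_rho := homo_ltn_inj inc_rho.
apply: (@lex_lt_mnm _ _ (rho r) (c' r)).
- by rewrite !mdeg_diag.
- move=> i lt_i j; rewrite !diagE; apply: eq_bigr => s _.
  case: eqP lt_i => [<- lt_s|//]; rewrite eq_c // ltnNge.
  rewrite leq_eqVlt; apply/negP => /orP[/eqP/val_inj eq_rs|/inc_rho].
    by rewrite eq_rs ltnn in lt_s.
  by rewrite ltnNge ltnW.
- move=> j lt_j; rewrite !diag_row //; case: (c r =P j) => [eq_cj|_].
    by move: lt_j; rewrite -eq_cj ltnNge ltnW.
  by case: eqP lt_j => // ->; rewrite ltnn.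
- rewrite !diag_row // eqxx; case: eqP => // eq_c'; by rewrite eq_c' ltnn in lt_c.
Qed.

Lemma det_mxsub_generic t (rho : 'I_t -> 'I_m) (c : 'I_t -> 'I_n) :
  \det (mxsub rho c X)
    = \sum_(s : 'S_t) (-1) ^+ s * 'X_[diag rho (fun r => c (s r))].
Proof.
apply: eq_bigr => s _; congr (_ * _); rewrite /diag -mprodXE.
by apply: eq_bigr => r _; rewrite !mxE.
Qed.

(** At the first row moved by s, the entry is pushed to the right, that is, to
    a smaller variable. *)
Lemma diag_perm_lt t (rho : 'I_t -> 'I_m) (c : 'I_t -> 'I_n) (s : 'S_t) :
    {homo rho : i j / (i < j)%N} -> {homo c : i j / (i < j)%N} -> s != 1%g ->
  (diag rho (fun r => c (s r)) < diag rho c)%O.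
Proof.
move=> inc_rho inc_c ne_s1.
have [|r ne_r fix_r] := @first_diff _ _ (fun r => s r) id.
  move=> eq_s; case/eqP: ne_s1; apply/permP => r; rewrite perm1; exact: eq_s.
have lt_r : (r < s r)%N.
  case: (ltngtP r (s r)) => // [/fix_r/perm_inj eq_s|/val_inj eq_s].
    by rewrite eq_s eqxx in ne_r.
  by rewrite -eq_s eqxx in ne_r.
by apply: (@diag_lt _ _ _ _ r) => // [q /fix_r->|]; last exact: inc_c.
Qed.

Lemma lead_minor t (rho : 'I_t -> 'I_m) (c : 'I_t -> 'I_n) :
    {homo rho : i j / (i < j)%N} -> {homo c : i j / (i < j)%N} ->
  \det (mxsub rho c X) != 0 /\ mlead (\det (mxsub rho c X)) = diag rho c.
Proof.
move=> inc_rho inc_c; set D := \det _.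
have D_E u : D@_u = \sum_(s : 'S_t) (-1) ^+ s * (diag rho (fun r => c (s r)) == u)%:R.
  rewrite /D det_mxsub_generic raddf_sum; apply: eq_bigr => s _ /=.
  by case: (odd_perm s); rewrite ?(expr0, expr1) ?mulN1r ?mul1r ?mcoeffN mcoeffX.
have D_lead : D@_(diag rho c) = 1.
  rewrite D_E (bigD1 1%g) //= odd_perm1 mul1r.
  rewrite (_ : diag rho (fun r => c ((1%g : 'S_t) r)) = diag rho c); last first.
    by apply: eq_bigr => r _; rewrite perm1.
  rewrite eqxx big1 ?addr0 // => s /(diag_perm_lt inc_rho inc_c).
  by rewrite lt_neqAle => /andP[/negPf-> _]; rewrite mulr0.
have nzD : D != 0.
  by apply/eqP => D0; move/eqP: D_lead; rewrite D0 mcoeff0 eq_sym oner_eq0.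
split=> //; apply/le_anti/andP; split; last first.
  by apply: msupp_le_mlead; rewrite mcoeff_msupp D_lead oner_eq0.
rewrite leNgt; apply/negP => lt_lead; move/mlead_supp: nzD.
rewrite mcoeff_msupp D_E big1 ?eqxx // => s _.
case: eqP => [eq_lead|]; last by rewrite mulr0.
have [s1|/(diag_perm_lt inc_rho inc_c)] := eqVneq s 1%g; last first.
  by rewrite eq_lead => /(lt_trans lt_lead); rewrite ltxx.
move: lt_lead; rewrite -eq_lead s1.
rewrite (_ : diag rho (fun r => c ((1%g : 'S_t) r)) = diag rho c) ?ltxx //.
by apply: eq_bigr => r _; rewrite perm1.
Qed.

Definition maxminor (c : {ffun 'I_m -> 'I_n}) : R := \det (colsub c X).

Lemma maxminorE c : maxminor c = \det (colsub c X).
Proof. by []. Qed.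

Lemma lead_maxminor c : increasing c ->
  maxminor c != 0 /\ mlead (maxminor c) = diag id c.
Proof. by move/increasingP => incc; apply: lead_minor. Qed.

Lemma dhomog_maxminor c : maxminor c \is m.-homog.
Proof.
rewrite maxminorE det_mxsub_generic rpred_sum // => s _.
rewrite -scale_sign; apply: dhomogZ; rewrite dhomogX; apply/eqP.
exact: mdeg_diag.
Qed.
End Minors.

(* Comparing two maximal minors up to conversion would expand both
   determinants. *)
Opaque maxminor.

(** * The maximal minors form a Groebner basis *)

Section Straightening.
Variables (K : fieldType) (m n k : nat).
Local Notation R := {mpoly K[m * n]}.
Local Notation X := (generic_mx m n K).
Local Notation idx := (@mxvec_index m n).
Implicit Types (c : {ffun 'I_m -> 'I_n}) (u v w : 'X_{1..m * n}) (f g : R).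

Definition cols_below c := increasing c && [forall r, (c r < k)%N].

(** The bound k on the columns produces the chain of primes that reaches the
    full ideal of maximal minors at k = n. *)
Definition maxminors_ideal : {pred R} := fun f =>
  `[< exists h : {ffun 'I_m -> 'I_n} -> R,
        f = \sum_(c | cols_below c) h c * maxminor K c >].
Local Notation J := maxminors_ideal.

Lemma maxminors_idealP f :
  reflect (exists h : {ffun 'I_m -> 'I_n} -> R,
             f = \sum_(c | cols_below c) h c * maxminor K c) (f \in J).
Proof. exact: asboolP. Qed.

Lemma maxminors_ideal0 : 0 \in J.
Proof.
apply/maxminors_idealP; exists (fun _ => 0).
by rewrite big1 // => c _; rewrite mul0r.
Qed.

Lemma maxminors_ideal_linear a f g : f \in J -> g \in J -> a * f + g \in J.
Proof.
move=> /maxminors_idealP[h ->] /maxminors_idealP[h' ->].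
apply/maxminors_idealP; exists (fun c => a * h c + h' c).
by rewrite mulr_sumr -big_split; apply: eq_bigr => c _; rewrite mulrDl mulrA.
Qed.

Lemma maxminors_idealMl a f : f \in J -> a * f \in J.
Proof.
move=> Jf; rewrite -[_ * _]addr0.
by rewrite maxminors_ideal_linear ?maxminors_ideal0.
Qed.

Lemma maxminors_idealD f g : f \in J -> g \in J -> f + g \in J.
Proof. by move=> Jf Jg; rewrite -[f]mul1r maxminors_ideal_linear. Qed.

Lemma maxminors_idealN f : f \in J -> - f \in J.
Proof. by move=> Jf; rewrite -mulN1r maxminors_idealMl. Qed.

Lemma maxminors_idealB f g : f \in J -> g \in J -> f - g \in J.
Proof. by move=> Jf Jg; rewrite maxminors_idealD ?maxminors_idealN. Qed.

Lemma maxminors_ideal_eq f g : f \in J -> g = f -> g \in J.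
Proof. by move=> ? ->. Qed.

Lemma mem_maxminor c : cols_below c -> maxminor K c \in J.
Proof.
move=> cc; apply/maxminors_idealP; exists (fun c' => (c' == c)%:R).
rewrite (bigD1 c) //= eqxx mul1r big1 ?addr0 // => c' /andP[_ /negPf->].
by rewrite mul0r.
Qed.

(** A variable x_il with c (i-1) < l < c i could replace x_(i, c i) in the
    diagonal of the minor on c, giving an earlier column set.  A reduced
    monomial contains no such variable, so that c is recovered from the
    product as its earliest diagonal ([reduced_diag_inj]). *)
Definition reduced c u := forall (i : 'I_m) (l : 'I_n),
  (forall r : 'I_m, (r < i)%N -> (c r < l)%N) -> (l < c i)%N -> u (idx i l) = 0%N.

Definition reduced_sum f := exists2 h : {ffun 'I_m -> 'I_n} -> R,
  f = \sum_(c | cols_below c) h c * maxminor K c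
  & forall c u, u \in msupp (h c) -> reduced c u.

Lemma reduced_sum0 : reduced_sum 0.
Proof.
exists (fun _ => 0) => [|c u]; last by rewrite msupp0.
by rewrite big1 // => c _; rewrite mul0r.
Qed.

Lemma reduced_sumD f g : reduced_sum f -> reduced_sum g -> reduced_sum (f + g).
Proof.
move=> [h -> rh] [h' -> rh']; exists (fun c => h c + h' c).
  by rewrite -big_split; apply: eq_bigr => c _; rewrite mulrDl.
by move=> c u /msuppD_le; rewrite mem_cat => /orP[/rh|/rh'].
Qed.

Lemma reduced_sumZ a f : reduced_sum f -> reduced_sum (a *: f).
Proof.
move=> [h -> rh]; exists (fun c => a *: h c).
  by rewrite scaler_sumr; apply: eq_bigr => c _; rewrite scalerAl.
by move=> c u /msuppZ_le/rh.
Qed.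

Lemma reduced_sum_sum I (r : seq I) (P : pred I) (F : I -> R) :
  (forall i, P i -> reduced_sum (F i)) -> reduced_sum (\sum_(i <- r | P i) F i).
Proof.
move=> rF; apply: big_ind => //; [exact: reduced_sum0 | exact: reduced_sumD].
Qed.

Lemma reduced_sum_term c u : cols_below c -> reduced c u ->
  reduced_sum ('X_[u] * maxminor K c).
Proof.
move=> cc ru; exists (fun c' => if c' == c then 'X_[u] else 0).
  rewrite (bigD1 c) //= eqxx big1 ?addr0 // => c' /andP[_ /negPf->].
  by rewrite mul0r.
by move=> c' v; case: eqP => [->|_]; rewrite ?msupp0 // => /mem_msuppXP <-.
Qed.

(** The Laplace expansion, along its first row, of the determinant of the
    columns C of X with row i repeated on top. *)
Lemma maxminor_relation (C : 'I_m.+1 -> 'I_n) (i : 'I_m) :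
  \sum_(q < m.+1) (-1) ^+ q * (X i (C q) * maxminor K [ffun r => C (lift q r)]) = 0.
Proof.
pose B : 'M[R]_m.+1 := \matrix_(r, q) X (odflt i (unlift ord0 r)) (C q).
have detB0 : \det B = 0.
  apply: (@determinant_alternate _ _ B ord0 (lift ord0 i)) => [//|q].
  by rewrite !mxE liftK unlift_none.
rewrite -[RHS]detB0 (expand_det_row B ord0); apply: eq_bigr => q _.
rewrite maxminorE /cofactor add0n !mxE unlift_none /= mulrCA.
congr (_ * (_ * \det _)).
by apply/matrixP => r s; rewrite !mxE ffunE liftK.
Qed.

Section RelationMonomials.
Variables (C : 'I_m.+1 -> 'I_n) (i : 'I_m).
Hypothesis incC : {homo C : q q' / (q < q')%N}.

(** The initial monomial of the q-th summand of [maxminor_relation].  As a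
    function of q it is largest at the two consecutive indices i and i+1, where
    it takes the same value, and only there. *)
Definition relation_mnm (q : 'I_m.+1) : 'X_{1..m * n} :=
  (U_(idx i (C q)) + diag id (fun r => C (lift q r)))%MM.

Lemma relation_mnmE q r j :
  relation_mnm q (idx r j)
    = ((i == r) && (C q == j) + (C (lift q r) == j))%N.
Proof. by rewrite mnmDE mnm1E mxvec_index_inj diag_id. Qed.

Lemma mdeg_relation_mnm q : mdeg (relation_mnm q) = m.+1.
Proof. by rewrite mdegD mdeg1 mdeg_diag. Qed.

Let ii := widen_ord (leqnSn m) i.

Lemma relation_mnm_eq : relation_mnm (lift ord0 i) = relation_mnm ii.
Proof.
apply/mnmP => p; case: (mxvec_indexP p) => r j; rewrite !relation_mnmE.
case: (ltngtP r i) => [lt_ri|lt_ir|/val_inj->].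
- by rewrite (neq_of_ltn lt_ri) !(@lift_lt _ _ r) //= ?/bump; lia.
- rewrite eq_sym (neq_of_ltn lt_ir) !(@lift_ge _ _ r) //=; rewrite /bump; lia.
- by rewrite eqxx (@lift_lt _ (lift ord0 i) i) // (@lift_ge _ ii i) // addnC.
Qed.

Lemma relation_mnm_lt q : q != ii -> q != lift ord0 i ->
  (relation_mnm q < relation_mnm ii)%O.
Proof.
move=> ne_q ne_q'; have eq_deg : mdeg (relation_mnm q) = mdeg (relation_mnm ii).
  by rewrite !mdeg_relation_mnm.
case: (ltnP q i) => [lt_qi|le_iq].
  pose r0 := Ordinal (ltn_trans lt_qi (ltn_ord i)).
  have eq_q : widen_ord (leqnSn m) r0 = q by apply: val_inj.
  have lt_q : (C q < C (lift ord0 r0))%N by apply: incC.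
  apply: (@lex_lt_mnm _ _ _ _ r0 (C q)) => //.
  - move=> r lt_rq j; rewrite !relation_mnmE.
    have lt_ri : (r < i)%N by exact: (ltn_trans lt_rq lt_qi).
    by rewrite (neq_of_ltn lt_ri) !lift_lt.
  - move=> j lt_j; rewrite !relation_mnmE (@neq_of_ltn _ i r0) //.
    rewrite (@lift_ge _ q r0) // (@lift_lt _ ii r0) // eq_q /= !neq_of_ltn //.
    exact: ltn_trans lt_j lt_q.
  - rewrite !relation_mnmE (@neq_of_ltn _ i r0) // (@lift_ge _ q r0) //.
    rewrite (@lift_lt _ ii r0) // eq_q.
    by rewrite eqxx (neq_of_ltn lt_q).
have lt_iq : (i.+1 < q)%N.
  rewrite ltn_neqAle; apply/andP; split.
    by apply: contraNneq ne_q' => eq_q; apply/eqP/val_inj.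
  rewrite ltn_neqAle le_iq andbT.
  by apply: contraNneq ne_q => eq_q; apply/eqP/val_inj.
have lt_C : (C ii < C (lift ord0 i))%N by apply: incC.
have lt_Cq : (C (lift ord0 i) < C q)%N by apply: incC.
apply: (@lex_lt_mnm _ _ _ _ i (C (lift ord0 i))) => //.
- move=> r lt_ri j; rewrite !relation_mnmE (neq_of_ltn lt_ri) !lift_lt //.
  by apply: ltn_trans lt_iq; apply: ltnW.
- move=> j lt_j; rewrite !relation_mnmE eqxx (lift_lt (ltnW lt_iq)) (@lift_ge _ ii i) //=.
  rewrite (@neq_of_ltn _ (C q)) ?(ltn_trans lt_j) //.
  by rewrite (@neq_of_ltn _ (C (lift ord0 i))) // addn0.
rewrite !relation_mnmE eqxx (lift_lt (ltnW lt_iq)) (@lift_ge _ ii i) //= -/ii eqxx.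
by rewrite (@neq_of_ltn _ (C q)) // eq_sym (neq_of_ltn lt_C).
Qed.
End RelationMonomials.

Definition insert_col c (i : 'I_m) (l : 'I_n) (q : 'I_m.+1) : 'I_n :=
  if unlift (widen_ord (leqnSn m) i) q is Some r then c r else l.

Lemma insert_col_homo c (i : 'I_m) (l : 'I_n) : increasing c ->
    (forall r : 'I_m, (r < i)%N -> (c r < l)%N) -> (l < c i)%N ->
  {homo insert_col c i l : q q' / (q < q')%N}.
Proof.
move=> /increasingP incc lt_cl lt_lc q q'; rewrite /insert_col.
have le_c (r r' : 'I_m) : (r <= r')%N -> (c r <= c r')%N.
  by rewrite leq_eqVlt => /orP[/eqP/val_inj->//|/incc/ltnW].
case: unliftP => [r ->|->]; case: unliftP => [r' ->|->] //=;
  rewrite /bump; last by rewrite ltnn.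
- by move=> lt_rr'; apply: incc; move: lt_rr'; lia.
- by move=> lt_ri; apply: lt_cl; move: lt_ri; lia.
- by move=> lt_ir'; apply: leq_trans lt_lc _; apply: le_c; move: lt_ir'; lia.
Qed.

(** A non-reduced product contains a variable x_il with c (i-1) < l < c i.  In
    the relation on the columns of c together with l, it is the term with index
    i; the term with index i+1 has the same initial monomial and an earlier
    column set, all others have smaller initial monomials.  The induction is
    on the initial monomial, then on the sum of the columns. *)
Lemma straighten u c : cols_below c -> reduced_sum ('X_[u] * maxminor K c).
Proof.
move: {2}(u + diag id c)%MM (erefl (u + diag id c)%MM) => w.
elim/(@ltmwf (m * n)): w u c => w IHw u c.
have [s lt_s] := ubnP (\sum_r c r)%N; elim: s u c lt_s => // s IHs u c lt_s Ew cc.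
have [ru|] := pselect (reduced c u); first exact: reduced_sum_term.
move=> /existsNP[i] /existsNP[l] /not_implyP[lt_cl] /not_implyP[lt_lc].
move=> /eqP; rewrite -lt0n => u_gt0; have incc : increasing c by case/andP: cc.
pose C := insert_col c i l; pose ii := widen_ord (leqnSn m) i.
have incC : {homo C : q q' / (q < q')%N} by exact: insert_col_homo.
have Cii : C ii = l by rewrite /C /insert_col unlift_none.
have Clift : [ffun r => C (lift ii r)] = c.
  by apply/ffunP => r; rewrite ffunE /C /insert_col liftK.
have ltCk q : (C q < k)%N.
  rewrite /C /insert_col; case: unlift => [r|]; first by case/andP: cc => _ /forallP.
  by apply: ltn_trans lt_lc _; case/andP: cc => _ /forallP.
have colsC q : cols_below [ffun r => C (lift q r)].
  apply/andP; split; last by apply/forallP => r; rewrite ffunE.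
  apply/increasingP => r r' lt_rr'; rewrite !ffunE; apply: incC => /=.
  by rewrite /bump; move: lt_rr'; lia.
(* From now on only the facts above about C matter; keeping its body makes
   unification expensive. *)
clearbody C; pose v := (u - U_(idx i l))%MM.
have Eu : u = (U_(idx i l) + v)%MM.
  by rewrite addmC submK // lep1mP -lt0n.
have lead_q q : (v + U_(idx i (C q)) + diag id [ffun r => C (lift q r)])%MM
    = (v + relation_mnm C i q)%MM.
  rewrite -addmA; congr (_ + (_ + _))%MM.
  by apply: eq_bigr => r _; rewrite ffunE.
have Ew' : w = (v + relation_mnm C i ii)%MM.
  by rewrite -lead_q Clift Cii (addmC v) -Eu Ew.
pose T q : R := 'X_[v + U_(idx i (C q))] * maxminor K [ffun r => C (lift q r)].
have sumT : \sum_(q < m.+1) ((-1) ^+ q : K) *: T q = 0.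
  have /(congr1 ( *%R 'X_[v])) := maxminor_relation C i.
  rewrite mulr0 mulr_sumr => rel; rewrite -[RHS]rel.
  apply: eq_bigr => q _; rewrite /T mpolyXD scale_sign mxE -mulrA.
  exact: mulrCA.
have T_ii : T ii = 'X_[u] * maxminor K c by rewrite /T Cii Clift addmC -Eu.
have lift_ii : lift (lift ord0 i) i = ii by apply: lift_lt.
have rT q : q != ii -> reduced_sum (T q).
  move=> ne_q.
  have [eq_q|ne_q'] := eqVneq q (lift ord0 i); last first.
    apply: (IHw _ _ (v + U_(idx i (C q)))%MM [ffun r => C (lift q r)] erefl (colsC q)).
    by rewrite lead_q Ew' ltmc_add2r; apply: relation_mnm_lt.
  apply: (IHs _ [ffun r => C (lift q r)] _ _ (colsC q)); last first.
    by rewrite lead_q eq_q relation_mnm_eq.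
  rewrite -ltnS; apply: leq_trans lt_s; rewrite ltnS.
  apply: (@ltn_sum_at _ _ _ i) => [r|]; rewrite ffunE eq_q; last first.
    by rewrite lift_ii Cii.
  have [->|ne_ri] := eqVneq r i; first by rewrite lift_ii Cii ltnW.
  rewrite -{1}Clift ffunE; suff -> : lift (lift ord0 i) r = lift ii r by [].
  apply: val_inj; move: ne_ri; rewrite -val_eqE /= /bump; lia.
rewrite -T_ii; clearbody T; rewrite (bigD1 ii) //= in sumT.
rewrite -[T ii]scale1r -(sqrr_sign K ii) expr2 -scalerA.
apply: reduced_sumZ; move/eqP: sumT; rewrite addr_eq0 => /eqP->.
rewrite -scaleN1r; apply/reduced_sumZ/reduced_sum_sum => q ne_q.
exact/reduced_sumZ/rT.
Qed.

Lemma reduced_sumP f : f \in J -> reduced_sum f.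
Proof.
move=> /maxminors_idealP[h ->]; apply: reduced_sum_sum => c cc.
rewrite [h c]mpolyE mulr_suml; apply: reduced_sum_sum => u _.
by rewrite -scalerAl; apply/reduced_sumZ/straighten.
Qed.

(** At the first row where c and c' differ, the smaller of the two columns
    gives a variable of the common product that the reducedness of the other
    factor excludes. *)
Lemma reduced_diag_inj c c' u u' : increasing c -> increasing c' ->
  reduced c u -> reduced c' u' -> (u + diag id c = u' + diag id c')%MM -> c = c'.
Proof.
suff aux c1 c2 u1 u2 (r : 'I_m) : increasing c2 -> reduced c1 u1 ->
    (u1 + diag id c1 = u2 + diag id c2)%MM ->
    (forall s : 'I_m, (s < r)%N -> c1 s = c2 s) -> ~ (c2 r < c1 r)%N.
  move=> incc incc' ru ru' eq_uc; apply/ffunP; apply/notP => /first_diff[r].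
  rewrite -val_eqE neq_ltn => /orP[] lt_r eq_c.
    by apply: (aux c' c u' u r) => // s lt_sr; rewrite eq_c.
  exact: (aux c c' u u' r).
move=> incc2 ru eq_uc eq_c lt_r.
have := congr1 (fun v : 'X_{1..m * n} => v (idx r (c2 r))) eq_uc.
rewrite !mnmDE !diag_id ru // ?(neq_of_ltn lt_r) ?eqxx /=; first by lia.
by move=> s lt_sr; rewrite eq_c //; move/increasingP: incc2; apply.
Qed.

(** In a reduced sum the initial monomials of the nonzero summands are pairwise
    distinct, so the largest one survives. *)
Theorem lead_maxminors_ideal f : f \in J -> f != 0 ->
  exists2 c, cols_below c & (diag id c <= mlead f)%MM.
Proof.
move=> /reduced_sumP[h Ef rh] nzf.
pose P c := cols_below c && (h c != 0).
have {}Ef : f = \sum_(c <- index_enum {ffun 'I_m -> 'I_n} | P c) h c * maxminor K c.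
  rewrite Ef [RHS]big_mkcondr /=; apply: eq_bigr => c _.
  by case: eqP => //= ->; rewrite mul0r.
have leadP c : P c -> mlead (h c * maxminor K c) = (mlead (h c) + diag id c)%MM.
  case/andP=> /andP[/(lead_maxminor K)[nzc <-] _] nzh; exact: mleadM.
have mem_filter_P c : c \in filter P (index_enum _) -> P c.
  by rewrite mem_filter => /andP[].
have Ulead : uniq [seq mlead (h c * maxminor K c) |
                    c <- index_enum {ffun 'I_m -> 'I_n} & P c].
  rewrite map_inj_in_uniq; first by rewrite filter_uniq ?index_enum_uniq.
  move=> c c' /mem_filter_P Pc /mem_filter_P Pc'.
  move=> eq_lead; have := etrans (esym (leadP c Pc)) (etrans eq_lead (leadP c' Pc')).
  case/andP: Pc => /andP[incc _] nzh; case/andP: Pc' => /andP[incc' _] nzh'.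
  exact: reduced_diag_inj incc incc' (rh c _ (mlead_supp nzh))
    (rh c' _ (mlead_supp nzh')).
move: (mlead_sum Ulead); rewrite -Ef => ->.
case: bigjoinPcond => [||c _ Pc]; first exact: le_total.
  move/allP => noP; case/eqP: nzf; rewrite Ef big1_seq // => c /andP[Pc /noP].
  by rewrite /= Pc.
by exists c; [case/andP: Pc | rewrite leadP // lem_addl].
Qed.
End Straightening.

(** * Primality *)

Section Prime.
Variables (K : fieldType) (p n k : nat).
Hypothesis le_pn : (p <= n)%N.
Local Notation R := {mpoly K[p.+1 * n]}.
Local Notation X := (generic_mx p.+1 n K).
Local Notation idx := (@mxvec_index p.+1 n).
Local Notation J := (@maxminors_ideal K p.+1 n k).
Implicit Types (c : {ffun 'I_p.+1 -> 'I_n}) (u v w : 'X_{1..p.+1 * n}) (f g : R).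

Definition lower_left (T : Type) (A : 'M[T]_(p.+1, n)) : 'M_p :=
  mxsub (lift ord0) (widen_ord le_pn) A.

Definition delta : R := \det (lower_left X).

Lemma lead_delta : delta != 0 /\
  mlead delta = diag (lift ord0) (widen_ord le_pn).
Proof. by apply: lead_minor. Qed.

(** The entries selected by c lie on or above the main diagonal of X since
    i <= c i, and those of the diagonal of delta lie strictly below it. *)
Lemma lead_delta_coprime c i : increasing c -> mlead delta (idx i (c i)) = 0%N.
Proof.
move=> incc; rewrite lead_delta.2 diagE big1 // => r _.
case: eqP => //= eq_i; case: eqP => // eq_c; move: (increasing_ge i incc).
by rewrite -eq_c -eq_i /= /bump /= ltnn.
Qed.

(** By the Groebner basis property and coprimality, some diagonal divides the
    initial monomial of f itself; subtracting a multiple of the corresponding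
    minor lowers the initial monomial of f. *)
Lemma delta_regular f : delta * f \in J -> f \in J.
Proof.
move: {2}(mlead f) (erefl (mlead f)) => w.
elim/(@ltmwf (p.+1 * n)): w f => w IHw f Ew Jdf.
have [->|nzf] := eqVneq f 0; first exact: maxminors_ideal0.
have [nzd _] := lead_delta.
have [|c cc] := lead_maxminors_ideal Jdf; first by rewrite mulf_neq0.
rewrite mleadM // => /mnm_lepP le_c; have incc : increasing c by case/andP: cc.
have {}le_c : (diag id c <= mlead f)%MM.
  apply/mnm_lepP => q; move: (le_c q); case: (mxvec_indexP q) => i j.
  rewrite mnmDE diag_id; case: eqP => // <-.
  by rewrite lead_delta_coprime.
have [nzc leadc] := lead_maxminor K incc.
pose a := mleadc f / mleadc (maxminor K c).
pose g := (a *: 'X_[mlead f - diag id c]) * maxminor K c.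
have Jg : g \in J by apply/maxminors_idealMl/mem_maxminor.
suff : f - g \in J by move/(maxminors_idealD Jg); rewrite addrC subrK.
have nza : a != 0 by rewrite mulf_neq0 ?invr_eq0 ?mleadc_eq0.
have leadg : mlead g = mlead f.
  rewrite mleadM ?mleadZ ?mleadXm ?leadc ?submK //.
  by rewrite scaler_eq0 negb_or nza -msupp_eq0 msuppX.
have g_lead : g@_(mlead f) = mleadc f.
  have := mleadcM (a *: 'X_[mlead f - diag id c]) (maxminor K c).
  rewrite mleadZ // mleadXm mcoeffZ mcoeffX eqxx mulr1 leadc submK // => ->.
  by rewrite -leadc divfK ?mleadc_eq0.
have [->|nzfg] := eqVneq (f - g) 0; first exact: maxminors_ideal0.
apply: (IHw (mlead (f - g))) => //; last first.
  by rewrite mulrBr maxminors_idealB // maxminors_idealMl.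
rewrite -Ew lt_neqAle; apply/andP; split.
  apply: contra_neq nzfg => eq_lead; apply/eqP; rewrite -mleadc_eq0 eq_lead.
  by rewrite mcoeffB g_lead subrr.
by apply: le_trans (mleadB_le _ _) _; rewrite leadg joinxx.
Qed.

Definition excluded (q : 'I_(p.+1 * n)) : bool :=
  [exists j, (q == idx ord0 j) && (p <= j < k)%N].

Lemma excludedE i j : excluded (idx i j) = (i == ord0) && (p <= j < k)%N.
Proof.
apply/existsP/andP => [[j' /andP[]]|[/eqP-> j_k]].
  by rewrite mxvec_index_inj => /andP[-> /eqP->].
by exists j; rewrite eqxx.
Qed.

(** The subring S of polynomials without excluded variables is handled as the
    set of fixed points of this ring endomorphism, which makes its closure
    properties immediate. *)
Definition kill_excluded : R -> R :=
  mmap (@mpolyC _ K) (fun q => if excluded q then 0 else 'X_q).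
HB.instance Definition _ := GRing.RMorphism.on kill_excluded.
Local Notation theta := kill_excluded.

Lemma kill_excludedC a : theta a%:MP = a%:MP.
Proof. exact: mmapC. Qed.

Lemma kill_excludedX q : theta 'X_q = if excluded q then 0 else 'X_q.
Proof. by rewrite /theta mmapX mmap1U. Qed.

Lemma kill_excluded_det t (M : 'M[R]_t) :
  (forall i j, theta (M i j) = M i j) -> theta (\det M) = \det M.
Proof.
by move=> fixM; rewrite -det_map_mx; congr (\det _); apply/matrixP => i j; rewrite mxE.
Qed.

Lemma kill_excluded_delta : theta delta = delta.
Proof.
apply: kill_excluded_det => r s; rewrite !mxE kill_excludedX excludedE.
by rewrite eq_sym (negPf (neq_lift _ _)).
Qed.

Definition border_cols (j : 'I_n) : {ffun 'I_p.+1 -> 'I_n} :=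
  [ffun r => if unlift ord_max r is Some s then widen_ord le_pn s else j].

Lemma border_cols_max j : border_cols j ord_max = j.
Proof. by rewrite ffunE unlift_none. Qed.

Lemma border_cols_lift j s : border_cols j (lift ord_max s) = widen_ord le_pn s.
Proof. by rewrite ffunE liftK. Qed.

Lemma cols_below_border k' (j : 'I_n) :
  (p <= j < k')%N -> cols_below k' (border_cols j).
Proof.
move=> /andP[le_pj lt_jk]; apply/andP; split; last first.
  apply/forallP => r; case: (unliftP ord_max r) => [s ->|->].
    rewrite border_cols_lift /=; apply: leq_trans (ltn_ord s) _.
    exact: leq_trans le_pj (ltnW lt_jk).
  by rewrite border_cols_max.
apply/increasingP => r r'.
case: (unliftP ord_max r) => [s ->|->]; case: (unliftP ord_max r') => [s' ->|->];
  rewrite ?border_cols_lift ?border_cols_max ?lift_max //= ?ltnn //.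
  by move=> _; exact: leq_trans (ltn_ord s) le_pj.
by move=> /(ltn_trans (ltn_ord s')); rewrite ltnn.
Qed.

(** Expand the maximal minor on the columns 0, ..., p-1 and j along its last
    column: the cofactor of x_0j is delta up to sign, and all other terms are
    free of excluded variables. *)
Lemma cramer (j : 'I_n) : (p <= j < k)%N ->
  exists2 g, theta g = g & delta * X ord0 j - g \in J.
Proof.
move=> /andP[le_pj lt_jk].
pose c := border_cols j; have cc : cols_below k c by exact/cols_below_border/andP.
have minors i : row' i (col' ord_max (colsub c X))
    = mxsub (lift i) (widen_ord le_pn) X.
  by apply/matrixP => r s; rewrite !mxE border_cols_lift.
pose F i : R := X i j * ((-1) ^+ (i + p) * \det (mxsub (lift i) (widen_ord le_pn) X)).
pose h := \sum_(i < p.+1 | i != ord0) F i.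
have Ec : maxminor K c = (-1) ^+ p * (delta * X ord0 j) + h.
  rewrite maxminorE (expand_det_col (colsub c X) ord_max).
  rewrite (eq_bigr F) => [|i _].
    by rewrite (bigD1 ord0) // /F add0n mulrCA (mulrC (X _ _)).
  by rewrite /F /cofactor minors !mxE border_cols_max.
exists (- ((-1) ^+ p * h)); last first.
  suff -> : delta * X ord0 j - - ((-1) ^+ p * h) = (-1) ^+ p * maxminor K c.
    by apply/maxminors_idealMl/mem_maxminor.
  by rewrite Ec opprK mulrDr mulrA -expr2 sqrr_sign mul1r.
rewrite rmorphN rmorphM rmorph_sign; congr (- (_ * _)).
rewrite rmorph_sum; apply: eq_bigr => i nz_i; rewrite /F !rmorphM rmorph_sign /=.
rewrite kill_excluded_det => [|r s]; last first.
  rewrite !mxE kill_excludedX excludedE /= leqNgt ltn_ord andbF //.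
by rewrite !mxE kill_excludedX excludedE (negPf nz_i).
Qed.

Lemma delta_reduction f :
  exists N g, theta g = g /\ delta ^+ N * f - g \in J.
Proof.
elim/mpoly_rmorph_ind: f => [a|q|f1 f2 IH1 IH2|f1 f2 IH1 IH2].
- by exists 0%N, a%:MP; rewrite expr0 mul1r subrr kill_excludedC maxminors_ideal0.
- have [ex_q|nex_q] := boolP (excluded q); last first.
    exists 0%N, 'X_q.
    by rewrite expr0 mul1r subrr kill_excludedX (negPf nex_q) maxminors_ideal0.
  move: ex_q; case: (mxvec_indexP q) => i j; rewrite excludedE => /andP[/eqP-> j_k].
  have [g fix_g Jg] := cramer j_k; exists 1%N, g; split=> //.
  by move: Jg; rewrite mxE.
- have [N1 [g1 [fix1 J1]]] := IH1; have [N2 [g2 [fix2 J2]]] := IH2.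
  exists (N1 + N2)%N, (delta ^+ N2 * g1 + delta ^+ N1 * g2); split.
    by rewrite rmorphD !rmorphM !rmorphXn /= kill_excluded_delta fix1 fix2.
  apply: maxminors_ideal_eq (maxminors_idealD
    (maxminors_idealMl (delta ^+ N2) J1) (maxminors_idealMl (delta ^+ N1) J2)) _.
  by rewrite exprD; ring.
have [N1 [g1 [fix1 J1]]] := IH1; have [N2 [g2 [fix2 J2]]] := IH2.
exists (N1 + N2)%N, (g1 * g2); split; first by rewrite rmorphM /= fix1 fix2.
apply: maxminors_ideal_eq (maxminors_idealD
  (maxminors_idealMl (delta ^+ N2 * f2) J1) (maxminors_idealMl g1 J2)) _.
by rewrite exprD; ring.
Qed.

(** The evaluation phi sends X to a matrix A over the field of fractions whose
    first row is, on the columns below k, the combination of the other rows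
    with coefficients t.  These are the solution of a linear system with
    determinant delta, chosen so that A agrees with X outside the excluded
    entries. *)
Section GenericPoint.
Local Notation L := {fraction R}.
Let iota : R -> L := @tofrac R.
Let Y : 'M[L]_p := map_mx iota (lower_left X).
Let t : 'rV[L]_p := (\row_s iota (X ord0 (widen_ord le_pn s))) *m invmx Y.
Let A : 'M[L]_(p.+1, n) := \matrix_(i, j)
  if excluded (idx i j) then \sum_s t 0 s * iota (X (lift ord0 s) j)
  else iota (X i j).
Let phi : R -> L := mmap (iota \o @mpolyC _ K) (fun q => mxvec A 0 q).
HB.instance Definition _ := GRing.RMorphism.on phi.
HB.instance Definition _ := GRing.RMorphism.on iota.

Let Y_unit : Y \in unitmx.
Proof.
by rewrite unitmxE unitfE det_map_mx tofrac_eq0; have [] := lead_delta.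
Qed.

Let A_row0 (j : 'I_n) : (j < k)%N -> A ord0 j = \sum_s t 0 s * A (lift ord0 s) j.
Proof.
move=> lt_jk; rewrite [LHS]mxE excludedE eqxx lt_jk andbT /=.
have -> : \sum_s t 0 s * A (lift ord0 s) j = \sum_s t 0 s * iota (X (lift ord0 s) j).
  by apply: eq_bigr => s _; rewrite [A _ _]mxE excludedE eq_sym (negPf (neq_lift _ _)).
case: leqP => // lt_jp; have {1}-> : j = widen_ord le_pn (Ordinal lt_jp).
  exact: val_inj.
have -> : iota (X ord0 (widen_ord le_pn (Ordinal lt_jp))) = (t *m Y) 0 (Ordinal lt_jp).
  by rewrite /t (mulmxKV Y_unit) [RHS]mxE.
rewrite mxE; apply: eq_bigr => s _; rewrite !mxE.
by congr (_ * iota (mpolyX _ U_(idx _ _))); apply: val_inj.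
Qed.

(** The row vector (-1, t) is a nonzero element of the left kernel. *)
Let phi_minor c : cols_below k c -> phi (maxminor K c) = 0.
Proof.
case/andP=> _ /forallP lt_ck; rewrite maxminorE -det_map_mx.
have -> : map_mx phi (colsub c X) = colsub c A.
  by apply/matrixP => i j; rewrite !mxE /phi mmapX mmap1U mxvecE !mxE.
apply/eqP/det0P; exists (\row_i if unlift ord0 i is Some s then t 0 s else -1).
  apply/eqP => /rowP/(_ ord0)/eqP; rewrite !mxE unlift_none oppr_eq0.
  by rewrite oner_eq0.
apply/rowP => r; rewrite mxE big_ord_recl.
have colE i : colsub c A i r = A i (c r) by rewrite mxE.
rewrite colE [(\row_i _) _ _]mxE unlift_none mulN1r A_row0 // [RHS]mxE.
apply/eqP; rewrite addrC subr_eq0; apply/eqP/eq_bigr => s _.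
by rewrite colE [(\row_i _) _ _]mxE liftK.
Qed.

Let phi_J f : f \in J -> phi f = 0.
Proof.
move=> /maxminors_idealP[h ->]; rewrite rmorph_sum big1 // => c cc.
by rewrite rmorphM /= phi_minor // mulr0.
Qed.

(** The evaluation phi is the inclusion in the field of fractions on S, and
    vanishes on the ideal. *)
Lemma kill_excluded_maxminors_ideal f : theta f = f -> f \in J -> f = 0.
Proof.
move=> fix_f /phi_J phi0; apply/eqP; rewrite -(tofrac_eq0 f); apply/eqP.
suff /(_ f) : forall g, phi (theta g) = iota (theta g).
  by rewrite fix_f phi0 => /esym.
apply: (@eq_mpoly_rmorph _ _ _ (phi \o theta) (iota \o theta)) => [a|q] /=.
  by rewrite kill_excludedC /phi mmapC.
rewrite kill_excludedX; case: ifP => [_|nex_q]; first by rewrite !rmorph0.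
rewrite /phi mmapX mmap1U; move: nex_q; case: (mxvec_indexP q) => i j nex_ij.
by rewrite mxvecE !mxE nex_ij.
Qed.
End GenericPoint.

Lemma maxminors_ideal_closed : idealr_closed J.
Proof.
split=> [||a f g]; [exact: maxminors_ideal0| |exact: maxminors_ideal_linear].
apply/negP => J1; have /eqP := kill_excluded_maxminors_ideal (kill_excludedC 1) J1.
by rewrite oner_eq0.
Qed.

(** Up to powers of delta, which can be cancelled, the factors f and g may be
    replaced by elements of S; their product lies in S and in the ideal, hence
    is 0. *)
Theorem maxminors_ideal_prime : prime_ideal J.
Proof.
split=> [|f g Jfg]; first exact: maxminors_ideal_closed.
have [N1 [f1 [fix1 J1]]] := delta_reduction f.
have [N2 [g1 [fix2 J2]]] := delta_reduction g.
have regular N h : delta ^+ N * h \in J -> h \in J.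
  elim: N => [|N IHN]; first by rewrite expr0 mul1r.
  by rewrite exprS -mulrA => /delta_regular.
have : f1 * g1 = 0.
  apply: kill_excluded_maxminors_ideal; first by rewrite rmorphM /= fix1 fix2.
  apply: maxminors_ideal_eq (maxminors_idealB
    (maxminors_idealMl (delta ^+ (N1 + N2)) Jfg)
    (maxminors_idealD (maxminors_idealMl (delta ^+ N2 * g) J1)
                      (maxminors_idealMl f1 J2))) _.
  by rewrite exprD; ring.
move/eqP; rewrite mulf_eq0 => /orP[]/eqP eq0; apply/orP; [left|right].
  by apply: (regular N1); move: J1; rewrite eq0 subr0.
by apply: (regular N2); move: J2; rewrite eq0 subr0.
Qed.
End Prime.

(** * Lengths of chains of primes *)

Section Growth.
Variables (K : fieldType) (N : nat).
Local Notation R := {mpoly K[N]}.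
Implicit Types (P Q : {pred R}) (I : finType) (f g : R).

Definition indep_mod P I (b : I -> R) :=
  forall c : I -> K, \sum_i c i *: b i \in P -> forall i, c i = 0.

(** In a relation modulo P between the g ^ e * b i, the part with e = 0 lies in
    Q since g does, so its coefficients vanish; the rest is divisible by g,
    which can be cancelled since P is prime and does not contain g. *)
Lemma indep_mod_powers P Q I (b : I -> R) g d :
    prime_ideal P -> idealr_closed Q -> {subset P <= Q} ->
    g \in Q -> g \notin P -> indep_mod Q b ->
  indep_mod P (fun x : 'I_d * I => g ^+ x.1 * b x.2).
Proof.
move=> [idP primeP] idQ sPQ Qg nPg indb.
have aux (c : nat -> I -> K) : \sum_(e < d) g ^+ e * \sum_i c e i *: b i \in P ->
    forall (e : 'I_d) i, c e i = 0.
  elim: d c => [|d IHd] c; first by move=> _ [].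
  rewrite big_ord_recl expr0 mul1r.
  have -> : \sum_(e < d) g ^+ lift ord0 e * \sum_i c (lift ord0 e) i *: b i
      = g * \sum_(e < d) g ^+ e * \sum_i c e.+1 i *: b i.
    by rewrite mulr_sumr; apply: eq_bigr => e _; rewrite mulrA -exprS.
  set rest := \sum_(e < d) _ => Psum.
  have c0 : forall i, c 0%N i = 0.
    apply: indb; have [_ _ Qlin] := idQ.
    suff -> : \sum_i c 0%N i *: b i
        = - rest * g + (\sum_i c 0%N i *: b i + g * rest).
      exact: (Qlin _ _ _ Qg (sPQ _ Psum)).
    by ring.
  move: Psum; rewrite big1 ?add0r => [|i _]; last by rewrite c0 scale0r.
  case/primeP/orP => [Pg|/(IHd (fun e => c e.+1)) c1 e i]; first by rewrite Pg in nPg.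
  by case: (unliftP ord0 e) => [e' ->|->]; [exact: c1 | exact: c0].
move=> c; pose c' e i := oapp (fun e' : 'I_d => c (e', i)) 0 (insub e).
have c'E (e : 'I_d) i : c' e i = c (e, i) by rewrite /c' valK.
move=> Psum [e i]; rewrite -c'E; apply: aux.
suff -> : \sum_(e < d) g ^+ e * \sum_i c' e i *: b i
    = \sum_x c x *: (g ^+ x.1 * b x.2) by [].
rewrite (eq_bigr (fun e => \sum_i c (e, i) *: (g ^+ e * b i))) => [|e1 _].
  by rewrite pair_bigA; apply: eq_bigr => [[? ?]].
by rewrite mulr_sumr; apply: eq_bigr => i1 _; rewrite c'E scalerAr.
Qed.

(** Linear independence in the space of polynomials of degree less than e,
    whose monomials have all exponents less than e. *)
Lemma indep_mod_card P I (b : I -> R) e : 0 \in P -> indep_mod P b ->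
  (forall i, (msize (b i) <= e)%N) -> (#|I| <= e ^ N)%N.
Proof.
move=> P0 indb le_be.
pose M : 'M[K]_(#|I|, #|{: 'X_{1..N < e}}|) :=
  \matrix_(i, u) (b (enum_val i))@_(enum_val u : 'X_{1..N < e}).
have freeM : row_free M.
  apply: inj_row_free => v vM0; apply/rowP => i; rewrite [RHS]mxE.
  have <- : v 0 (enum_rank (enum_val i)) = v 0 i by rewrite enum_valK.
  apply: (indb (fun x => v 0 (enum_rank x))) (enum_val i).
  suff -> : \sum_x v 0 (enum_rank x) *: b x = 0 by [].
  apply/mpolyP => u; rewrite mcoeff0 raddf_sum /=.
  case: (ltnP (mdeg u) e) => [lt_ue|le_eu]; last first.
    rewrite big1 // => x _; rewrite mcoeffZ memN_msupp_eq0 ?mulr0 //.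
    by apply: msize_mdeg_ge; apply: leq_trans le_eu.
  have /rowP/(_ (enum_rank (BMultinom lt_ue))) := vM0.
  rewrite !mxE => sum0; rewrite -[RHS]sum0.
  rewrite (reindex (@enum_val I predT)) /=; last first.
    by apply: onW_bij; exact: enum_val_bij.
  by apply: eq_bigr => j _; rewrite mcoeffZ enum_valK !mxE enum_rankK.
have /leq_trans-> // : (#|I| <= #|{: 'X_{1..N < e}}|)%N.
  by move/eqP: freeM => <-; exact: rank_leq_col.
have lt_e (u : 'X_{1..N < e}) q : (u q < e)%N.
  apply: leq_ltn_trans (bmdeg u); rewrite mdegE (bigD1 q) //=; exact: leq_addr.
rewrite -[X in (_ <= X ^ _)%N]card_ord -[X in (_ <= _ ^ X)%N]card_ord -card_ffun.
apply: (@leq_card _ _ (fun u : 'X_{1..N < e} => [ffun q => Ordinal (lt_e u q)])).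
move=> u u' /ffunP eq_u; apply/val_inj/mnmP => q.
by have := eq_u q; rewrite !ffunE => /(congr1 val).
Qed.

(** For a prime Q, this bounds the transcendence degree of the quotient by Q
    from below by r, in terms of the growth of the dimensions of the spaces of
    elements of bounded degree; it replaces algebraic independence by linear
    algebra. *)
Definition growth Q (r : nat) := exists B, forall d, (0 < d)%N ->
  exists I, exists b : I -> R,
    [/\ indep_mod Q b, #|I| = (d ^ r)%N & forall i, (msize (b i) <= B * d)%N].

Lemma growth_step P Q r : prime_ideal P -> idealr_closed Q ->
  {subset P <= Q} -> ~ {subset Q <= P} -> growth Q r -> growth P r.+1.
Proof.
move=> primeP idQ sPQ nsQP [B growQ].
have [g Qg nPg] : exists2 g, g \in Q & g \notin P.
  apply: contra_notP nsQP => noex g Qg; apply: contra_notT noex => nPg.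
  by exists g.
exists (B + (msize g).+2)%N => d d_gt0; have [I [b [indb cardI le_b]]] := growQ d d_gt0.
exists ('I_d * I)%type, (fun x : 'I_d * I => g ^+ x.1 * b x.2); split.
- exact: indep_mod_powers indb.
- by rewrite card_prod card_ord cardI expnS.
move=> [e i] /=.
have le_g (j : nat) : (msize (g ^+ j) <= j * (msize g).+1 + 1)%N.
  elim: j => [|j IHj]; first by rewrite expr0 msize1.
  by rewrite exprS (leq_trans (msizeM_le _ _)) // mulSn; move: IHj; lia.
apply: leq_trans (msizeM_le (g ^+ e) (b i)) _.
have := leq_mul (ltn_ord e) (leqnn (msize g).+1).
by move: (le_g e) (le_b i) (ltn_ord e); nia.
Qed.

(** The value of d is such that d ^ (N + 1) > (B * d) ^ N. *)
Lemma growth_le P r : 0 \in P -> growth P r -> (r <= N)%N.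
Proof.
move=> P0 [B growP]; rewrite leqNgt; apply/negP => lt_Nr.
pose d := (B ^ N).+1.
have [I [b [indb cardI le_b]]] := growP d isT.
have := indep_mod_card P0 indb le_b; rewrite cardI leqNgt => /negP[].
rewrite expnMn; apply: (@leq_trans (d ^ N.+1)); last exact: leq_pexp2l.
by rewrite expnS ltn_pmul2r ?expn_gt0.
Qed.

Lemma growth_chain P k r : prime_chain P k -> growth P r -> (r + k <= N)%N.
Proof.
move=> [c [primec strictc eq_ck]] growP.
have growc : growth (c k) r.
  have [B growPB] := growP; exists B => d /growPB[I [b [indb ? ?]]].
  by exists I, b; split=> // a; rewrite eq_ck; apply: indb.
apply: (@growth_le (c 0%N)); first by have [[]] := primec 0%N isT.
have aux j : (j <= k)%N -> growth (c (k - j)%N) (r + j).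
  elim: j => [|j IHj] lt_jk; first by rewrite subn0 addn0.
  have lt_k : (k - j.+1 < k)%N by lia.
  have [sub_c nsub_c] := strictc _ lt_k; rewrite addnS.
  apply: (@growth_step _ (c (k - j.+1).+1)) => //; first exact/primec/ltnW.
    by have [] := primec _ lt_k.
  by rewrite -subSn // subSS; apply: IHj; apply: ltnW.
by have := aux k (leqnn k); rewrite subnn.
Qed.
End Growth.

(** * The height of the ideal of maximal minors *)

Section Height.
Variables (K : fieldType) (p n : nat).
Hypothesis lt_pn : (p < n)%N.
Let le_pn : (p <= n)%N := ltnW lt_pn.
Local Notation m := p.+1.
Local Notation R := {mpoly K[m * n]}.
Local Notation idx := (@mxvec_index m n).
Local Notation J := (@maxminors_ideal K m n).
Local Notation Ex := (@excluded p n n).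

(** The monomials without excluded variables and with exponents less than d
    are linearly independent modulo the ideal, since S meets it in 0. *)
Lemma growth_maxminors_ideal : growth (J n) #|[pred q | ~~ Ex q]|.
Proof.
exists (m * n).+1 => d d_gt0.
pose mon (a : {ffun {q | ~~ Ex q} -> 'I_d}) : 'X_{1..m * n} :=
  [multinom oapp (fun q' => a q' : nat) 0%N (insub q) | q < m * n].
have monE a (q : {q | ~~ Ex q}) : mon a (val q) = a q by rewrite mnmE valK.
have mon_ex a q : Ex q -> mon a q = 0%N.
  by move=> ex_q; rewrite mnmE insubF ?ex_q.
have mon_inj : injective mon.
  move=> a a' eq_a; apply/ffunP => q; apply: val_inj.
  by rewrite /= -!monE eq_a.
exists {ffun {q | ~~ Ex q} -> 'I_d}, (fun a => 'X_[mon a]); split.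
- move=> c Jc a.
  have sum0 : \sum_a c a *: 'X_[mon a] = 0 :> R.
    apply: kill_excluded_maxminors_ideal Jc => //.
    rewrite rmorph_sum; apply: eq_bigr => b _ /=.
    rewrite -mul_mpolyC rmorphM /= kill_excludedC mpolyXE_id rmorph_prod.
    congr (_ * _); apply: eq_bigr => q _; rewrite rmorphXn /= kill_excludedX.
    by case: ifP => // /mon_ex->; rewrite !expr0.
  have := congr1 (mcoeff (mon a)) sum0; rewrite mcoeff0 raddf_sum /= => <-.
  rewrite (bigD1 a) //= mcoeffZ mcoeffX eqxx mulr1 big1 ?addr0 // => b ne_ba.
  by rewrite mcoeffZ mcoeffX (inj_eq mon_inj) (negPf ne_ba) mulr0.
- by rewrite card_ffun card_ord card_sig.
move=> a; rewrite msizeX mdegE.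
have : (\sum_q mon a q <= \sum_(q < m * n) d.-1)%N.
  apply: leq_sum => q _; rewrite mnmE; case: insub => //= q'.
  by rewrite -ltnS prednK.
rewrite sum_nat_const card_ord; nia.
Qed.

Lemma card_excluded : (#|Ex| <= n - p)%N.
Proof.
have bnd (s : 'I_(n - p)) : (s + p < n)%N by have := ltn_ord s; lia.
pose f s := idx ord0 (Ordinal (bnd s)).
rewrite -[X in (_ <= X)%N](card_ord (n - p)).
apply: leq_trans (leq_image_card f predT); apply: subset_leq_card.
apply/subsetP => q /existsP[j /andP[/eqP-> /andP[le_pj lt_jn]]].
have lt_j : (j - p < n - p)%N by lia.
apply/imageP; exists (Ordinal lt_j) => //; congr (idx _ _); apply: val_inj => /=.
by rewrite subnK.
Qed.

Lemma height_maxminors_ideal_le k : prime_chain (J n) k -> (k <= n - p)%N.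
Proof.
move=> /growth_chain/(_ growth_maxminors_ideal).
have := cardC Ex; have := card_excluded; rewrite card_ord.
have -> : #|[predC Ex]| = #|[pred q | ~~ Ex q]| by apply: eq_card.
by move: #|_|; lia.
Qed.

Lemma cols_below_mono k k' c :
  (k <= k')%N -> @cols_below m n k c -> @cols_below m n k' c.
Proof.
move=> le_k /andP[incc /forallP lt_c]; rewrite /cols_below incc; apply/forallP => r.
exact: leq_trans (lt_c r) le_k.
Qed.

Lemma maxminors_ideal_mono k k' : (k <= k')%N -> {subset J k <= J k'}.
Proof.
move=> le_k f /maxminors_idealP[h ->]; elim/big_ind: _ => [|f1 f2|c cc].
- exact: maxminors_ideal0.
- exact: maxminors_idealD.
exact/maxminors_idealMl/mem_maxminor/(cols_below_mono le_k).
Qed.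

(** The minor on the columns 0, ..., p-1 and k has no diagonal on the first k
    columns dividing its initial monomial: in the last row, this monomial only
    involves column k. *)
Lemma maxminors_ideal_strict k :
  (p <= k)%N -> (k < n)%N -> ~ {subset J k.+1 <= J k}.
Proof.
move=> le_pk lt_kn sub_J; pose j := Ordinal lt_kn.
have cj : cols_below k.+1 (border_cols le_pn j).
  by apply: cols_below_border; rewrite le_pk /= ltnSn.
have [incj _] := andP cj; have [nz_minor lead_minor] := lead_maxminor K incj.
have [c cc /mnm_lepP le_c] :=
  lead_maxminors_ideal (sub_J _ (mem_maxminor K cj)) nz_minor.
move: (le_c (idx ord_max (c ord_max))).
rewrite lead_minor !diag_id eqxx border_cols_max lt0b => /eqP eq_j.
by case/andP: cc => _ /forallP/(_ ord_max); rewrite -eq_j /= ltnn.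
Qed.

Lemma height_maxminors_ideal : prime_height (J n) (n - p).
Proof.
split; [exact: maxminors_ideal_prime| |exact: height_maxminors_ideal_le].
exists (fun i => J (p + i)); split.
- by move=> i _; exact: maxminors_ideal_prime.
- move=> i lt_i; split; first by rewrite addnS; apply: maxminors_ideal_mono.
  by rewrite addnS; apply: maxminors_ideal_strict; lia.
by rewrite subnKC.
Qed.
End Height.

(** * Homogeneity, associated primes and the selected minors *)

Section Properties.
Variables (K : fieldType) (p n : nat).
Local Notation m := p.+1.
Local Notation X := (generic_mx m n K).
Local Notation J := (@maxminors_ideal K m n).

Lemma minors_idealE : minors_ideal m X =i J n.
Proof.
move=> f; apply/asboolP/maxminors_idealP => [[c ->]|[h ->]].
  apply/maxminors_idealP; elim/big_ind: _ => [|f1 f2|i _].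
  - exact: maxminors_ideal0.
  - exact: maxminors_idealD.
  apply: maxminors_idealMl; have : (minors m X)`_i \in minors m X by apply: mem_nth.
  case/imageP => [[f1 f2] /andP[/= /increasing_id inc1 inc2] ->].
  apply: (@maxminors_ideal_eq _ _ _ _ (maxminor K f2)).
    apply: mem_maxminor; rewrite /cols_below inc2; apply/forallP => r; exact: ltn_ord.
  rewrite maxminorE; congr (\det _); apply/matrixP => i1 j1; rewrite [LHS]mxE [RHS]mxE.
  by rewrite inc1.
suff : \sum_(c | cols_below n c) h c * maxminor K c \in minors_ideal m X by move/asboolP.
elim/big_ind: _ => [|f1 f2|c /andP[incc _]].
- exact: ideal_gen0.
- by move=> I1 I2; rewrite -[f1]mul1r; apply: ideal_gen_linear.
rewrite -[_ * _]addr0; apply: ideal_gen_linear; last exact: ideal_gen0.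
apply: ideal_gen_mem; apply/imageP; exists ([ffun i => i], c).
  by rewrite inE /= incc andbT; apply/increasingP => i1 i2; rewrite !ffunE.
by rewrite maxminorE; congr (\det _); apply/matrixP => i1 j1; rewrite !mxE ffunE.
Qed.

Lemma pihomog_maxminors_ideal k f d : f \in J k -> pihomog mdeg d f \in J k.
Proof.
move=> /maxminors_idealP[h ->]; rewrite raddf_sum; elim/big_ind: _ => [|f1 f2|c cc].
- exact: maxminors_ideal0.
- exact: maxminors_idealD.
rewrite [h c]mpolyE mulr_suml raddf_sum; elim/big_ind: _ => [|f1 f2|u _].
- exact: maxminors_ideal0.
- exact: maxminors_idealD.
have hom_u : (h c)@_u *: 'X_[u] * maxminor K c \is (mdeg u + m).-homog.
  by apply: dhomogM (dhomog_maxminor K c); apply: dhomogZ; rewrite dhomogX.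
have [<-|ne_d] := eqVneq (mdeg u + m)%N d.
  by rewrite /= (pihomog_dE hom_u); apply/maxminors_idealMl/mem_maxminor.
by rewrite /= (pihomog_ne0 ne_d hom_u) maxminors_ideal0.
Qed.

End Properties.

Lemma initial_mnmE (K : fieldType) N (f : {mpoly K[N]}) :
  initial_mnm (fun u v => (u <= v)%O) f = mlead f.
Proof.
rewrite /initial_mnm /mlead; elim: (msupp f) => [|u s IHs]; first by rewrite big_nil.
by rewrite big_cons /= IHs; case: leP.
Qed.

Lemma term_order_mnm N : term_order (fun u v : 'X_{1..N} => (u <= v)%O).
Proof.
split; split.
- exact: lexx.
- exact: le_anti.
- exact: le_trans.
- exact: le_total.
- exact: le0x.
by move=> u v w; rewrite lemc_add2l.
Qed.

(** It suffices to replace the last term of the chain by Q. *)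
Lemma prime_chain_extend (A : comNzRingType) (P Q : {pred A}) k :
  prime_ideal Q -> {subset P <= Q} -> prime_chain P k -> prime_chain Q k.
Proof.
move=> primeQ sPQ [c [primec strictc eq_ck]].
exists (fun i => if (i < k)%N then c i else Q); split=> [i _|i lt_ik|].
- by case: ifP => // lt_ik; apply/primec/ltnW.
- rewrite lt_ik; have [sub_c nsub_c] := strictc i lt_ik; case: ifP => // ge_ik.
  have eq_k : i.+1 = k by lia.
  have sub_cQ : {subset c i.+1 <= Q} by move=> f; rewrite eq_k eq_ck => /sPQ.
  split; first by move=> f /sub_c/sub_cQ.
  by move=> sub_Qc; apply: nsub_c => f /sub_cQ/sub_Qc.
by rewrite ltnn.
Qed.

(** If P is the annihilator of the class of f then f is not in I, and for such
    f, by primality, g * f is in I if and only if g is. *)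
Lemma prime_associated (A : comNzRingType) (I P : {pred A}) :
  prime_ideal I -> associated_prime I P -> P = I.
Proof.
move=> [[I0 nI1 Ilin] primeI] [[[P0 nP1 Plin] _] [f P_E]].
have nIf : f \notin I by rewrite -[f]mul1r -P_E.
apply/funext => g; apply/idP/idP => [Pg|Ig].
  have := P_E g; rewrite -[g \in P]/(P g) Pg => /esym/primeI/orP[] // If.
  by rewrite If in nIf.
rewrite -[P g]/(g \in P) P_E mulrC -[_ * _]addr0; exact: Ilin.
Qed.

Lemma prime_ideal_height (A : comNzRingType) (I : {pred A}) h :
  prime_height I h -> ideal_height I h.
Proof.
move=> ht_I; split; first by exists I.
move=> P k sIP [primeP _ max_k]; case: ht_I => _ chainI _.
exact/max_k/(prime_chain_extend primeP sIP).
Qed.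

Lemma consecutive_subproof p n (i : 'I_(n - p)) (r : 'I_p.+1) : (i + r < n)%N.
Proof. by have := ltn_ord i; have := ltn_ord r; lia. Qed.

Definition consecutive_cols p n (i : 'I_(n - p)) : {ffun 'I_p.+1 -> 'I_n} :=
  [ffun r => Ordinal (consecutive_subproof i r)].

Lemma cols_below_consecutive p n (i : 'I_(n - p)) : cols_below n (consecutive_cols i).
Proof.
apply/andP; split; last by apply/forallP => r; rewrite ltn_ord.
by apply/increasingP => r r' lt_r; rewrite !ffunE /= ltn_add2l.
Qed.

Theorem proposition4p6 (K : fieldType) (m n : nat)
    (m_gt0 : (0 < m)%N) (le_mn : (m <= n)%N) :
  property_P (minors_ideal m (generic_mx m n K)).
Proof.
case: m m_gt0 le_mn => // p _ lt_pn.
have -> : minors_ideal p.+1 (generic_mx p.+1 n K) = @maxminors_ideal K p.+1 n n.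
  by apply/funext => f; exact: minors_idealE f.
have ht := height_maxminors_ideal K lt_pn.
have primeJ : prime_ideal _ := let: And3 h _ _ := ht in h.
have lead_alpha (i : 'I_(n - p)) :=
  lead_maxminor K (proj1 (andP (cols_below_consecutive i))).
split.
- by split=> [|f d]; [case: primeJ | exact: pihomog_maxminors_ideal].
- by exists (n - p)%N => P /(prime_associated primeJ)->.
exists (n - p)%N; first exact: prime_ideal_height.
exists (fun u v => (u <= v)%O); first exact: term_order_mnm.
exists (fun i => maxminor K (consecutive_cols i)); split=> [i|i|i|i|i j ne_ij].
- exact/mem_maxminor/cols_below_consecutive.
- exact: homogE (dhomog_maxminor _ _).
- by case: (lead_alpha i).
- rewrite initial_mnmE (lead_alpha i).2 => q; case: (mxvec_indexP q) => r l.
  by rewrite diag_id leq_b1.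
rewrite !initial_mnmE (lead_alpha i).2 (lead_alpha j).2 => q.
case: (mxvec_indexP q) => r l; rewrite !diag_id !ffunE.
case: eqP => [<-|_]; last by rewrite min0n.
case: eqP => // /(congr1 val) /= /addIn/val_inj eq_ji.
by rewrite eq_ji eqxx in ne_ij.
Qed.
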